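(* For any real $\alpha$ with $0<\alpha<\frac{3+\sqrt5}2$, no deterministic online algorithm (not necessarily monotone) for maximizing a non-negative monotone submodular function under a partition matroid constraint with free disposal, on instances of the form described in the context (all parts of capacity $1$), can have competitive ratio strictly larger than $\frac1\alpha$.
   Context: Instances: let $\mathcal{U}$ be a universe of items with weights $\nu:\mathcal{U}\to\mathbb{R}_+$, and $\nu(X):=\sum_{x\in X}\nu(x)$ for $X\subseteq\mathcal{U}$. For $i\ge0$ let $\Omega_i:=\{(u,i):u\in\mathcal{U}\}$ and let $\Omega:=\bigcup_{i\ge0}\Omega_i$. A (finite) set $S\subset\Omega$ is independent iff $|S\cap\Omega_i|\le1$ for all $i$ (a partition matroid with unit capacities). The objective is $f(S):=\nu(\{x:(x,i)\in S\text{ for some }i\})$, which is monotone submodular. Online problem with free disposal: distinct elements of $\Omega$ arrive one by one in a finite sequence whose length is unknown to the algorithm. The algorithm maintains an independent set $S$, initially empty. When $u$ arrives, it may remove elements from $S$ and may include $u$ in $S$, as long as $S$ remains independent; rejected or removed elements cannot be retrieved. The algorithm has a value oracle for $f$ and an independence oracle, only on sets of elements that have arrived so far, so the decisions of a deterministic algorithm are determined by this information. $\mathsf{OPT}$ is an independent set of elements of the sequence maximizing $f$. A deterministic algorithm has competitive ratio $r$ if for every instance and at the end of every finite sequence, $f(S)\ge r\cdot f(\mathsf{OPT})$. *)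

(* Defs.v *)
From mathcomp Require Import all_boot all_order all_algebra.
From mathcomp Require Import finmap.
From mathcomp Require Import boolp reals.

Set Implicit Arguments.
Unset Strict Implicit.
Unset Printing Implicit Defensive.

Import Order.TTheory GRing.Theory Num.Theory.

Local Open Scope fset_scope.
Local Open Scope ring_scope.

(* The ground set Omega: (u, i) is the copy of item u in part Omega_i. *)
Definition element (U : choiceType) : choiceType := (U * nat)%type.

Definition independent (U : choiceType) (S : {fset element U}) : Prop :=
  forall i : nat, (#|` [fset p in S | p.2 == i]| <= 1)%N.

Definition weight (R : realType) (U : choiceType) (nu : U -> R)
    (X : {fset U}) : R :=
  \sum_(x <- X) nu x.

Definition objective (R : realType) (U : choiceType) (nu : U -> R)
    (S : {fset element U}) : R :=
  weight nu [fset p.1 | p in S].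

(* An algorithm sees the arrived elements only through their arrival positions:
   after n arrivals they are named by 'I_n, in order of arrival.  For a
   duplicate-free sequence s, [subfam s X] is the set of elements of s whose
   positions are in X. *)
Definition subfam (U : choiceType) (s : seq (element U)) (n : nat)
    (X : {set 'I_n}) : {fset element U} :=
  [fset x in s | [exists i in X, nat_of_ord i == index x s]].

Definition value_oracle (R : realType) (U : choiceType) (nu : U -> R)
    (s : seq (element U)) (n : nat) : {ffun {set 'I_n} -> R} :=
  [ffun X => objective nu (subfam s X)].

Definition indep_oracle (U : choiceType) (s : seq (element U)) (n : nat) :
    {ffun {set 'I_n} -> bool} :=
  [ffun X : {set 'I_n} => `[< independent (subfam s X) >]].

(* A deterministic algorithm: when the element at position n arrives, the
   decision is a function of the two oracles on all subsets of the n.+1 elements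
   that have arrived (discarded ones included) and of the current solution.  The
   decision is the pair of the set of positions to remove from the solution and
   of whether to include the new element.  The tables for shorter prefixes are
   restrictions of the given ones, so the whole history is available.  There is
   no computability restriction. *)
Definition algorithm (R : realType) : Type :=
  forall n : nat,
    {ffun {set 'I_n.+1} -> R} -> {ffun {set 'I_n.+1} -> bool} ->
    {set 'I_n} -> {set 'I_n} * bool.

Definition update (n : nat) (S : {set 'I_n}) (d : {set 'I_n} * bool) :
    {set 'I_n.+1} :=
  (widen_ord (leqnSn n) @: (S :\: d.1)
     :|: (if d.2 then [set ord_max] else set0))%SET.

(* The positions in the solution after the first n elements of s have arrived;
   only n <= size s is used. *)
Fixpoint solution_at (R : realType) (A : algorithm R) (U : choiceType)
    (nu : U -> R) (s : seq (element U)) (n : nat) : {set 'I_n} :=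
  match n with
  | 0 => set0%SET
  | m.+1 =>
      let S := solution_at A nu s m in
      update S (A m (value_oracle nu s m.+1) (indep_oracle s m.+1) S)
  end.

Definition solution (R : realType) (A : algorithm R) (U : choiceType)
    (nu : U -> R) (s : seq (element U)) (n : nat) : {fset element U} :=
  subfam s (solution_at A nu s n).

Definition feasible (R : realType) (A : algorithm R) : Prop :=
  forall (U : choiceType) (nu : U -> R) (s : seq (element U)) (n : nat),
    (forall u, 0 <= nu u) -> uniq s -> (n <= size s)%N ->
    independent (solution A nu s n).

Definition is_OPT (R : realType) (U : choiceType) (nu : U -> R)
    (s : seq (element U)) (O : {fset element U}) : Prop :=
  [/\ {subset O <= s}, independent O &
      forall T : {fset element U}, {subset T <= s} -> independent T ->
        objective nu T <= objective nu O].

Definition has_competitive_ratio (R : realType) (A : algorithm R) (r : R) :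
    Prop :=
  forall (U : choiceType) (nu : U -> R) (s : seq (element U))
      (O : {fset element U}),
    (forall u, 0 <= nu u) -> uniq s -> is_OPT nu s O ->
    r * objective nu O <= objective nu (solution A nu s (size s)).

(* Main.v *)
(* An adversary in rounds. In part 0 the algorithm holds an item a of weight w,
   and a twin b of the same weight is already lost. A distractor e of weight y
   arrives in a fresh part, followed by a copy of a in that part. If the
   algorithm gives up e to protect a, the adversary stops; otherwise it offers
   two new items of weight w' in part 0 and stops if both are rejected. If one is
   accepted, then a is lost for the algorithm while OPT keeps its copy, and the
   next round starts. When the adversary stops, it sends everything that the
   algorithm may hold once more, in fresh parts, for the benefit of OPT only.
   Choosing y and w' so that both ways of stopping yield exactly the ratio
   1 / alpha leads to w' = w + alpha y and y' = (alpha - 1) w' - alpha w. The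
   characteristic polynomial X^2 - (alpha^2 - alpha + 1) X + alpha^2 of this
   recurrence has no real root when alpha^2 - 3 alpha + 1 < 0, so that y <= 0
   after finitely many rounds, and then no distractor is needed to stop. *)

Require Import Defs.
From mathcomp Require Import all_boot all_order all_algebra.
From mathcomp Require Import finmap.
From mathcomp Require Import boolp reals.
From mathcomp Require Import ring lra.

Set Implicit Arguments.
Unset Strict Implicit.
Unset Printing Implicit Defensive.

Import Order.TTheory GRing.Theory Num.Theory.

Local Open Scope fset_scope.
Local Open Scope ring_scope.


(** * Independent sets, the objective and optima *)

Lemma fresh_nat (l : seq nat) : exists n, n \notin l.
Proof.
exists (\max_(i <- l) i).+1; apply/negP => nl.
by have := @leq_bigmax_seq _ l xpredT id _ nl isT; rewrite ltnn.
Qed.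

Lemma independentP (U : choiceType) (S : {fset element U}) :
  independent S <->
  (forall p q, p \in S -> q \in S -> p.2 = q.2 -> p = q).
Proof.
split=> [indS p q pS qS pq|injS i].
  apply/eqP; apply: contraT => npq.
  suff: (1 < #|` [fset x in S | x.2 == p.2]|)%N by rewrite ltnNge indS.
  have <- : #|` [fset p; q]| = 2%N by rewrite cardfs2 npq.
  apply: fsubset_leq_card; apply/fsubsetP => x.
  by rewrite !inE => /orP[]/eqP->; rewrite ?pS ?qS ?pq eqxx.
have [->|[p]] := fset_0Vmem [fset x in S | x.2 == i]; first by rewrite cardfs0.
rewrite !inE => /andP[/= pS /eqP pi].
rewrite -(cardfs1 p); apply: fsubset_leq_card; apply/fsubsetP => x.
by rewrite !inE => /andP[/= xS /eqP xi]; apply/eqP/injS; rewrite ?xi ?pi.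
Qed.

Lemma independentU1 (U : choiceType) (T : {fset element U}) p :
  independent T -> (forall q, q \in T -> q.2 <> p.2) -> independent (p |` T).
Proof.
move=> /independentP indT pT; apply/independentP => x y.
rewrite !inE => /orP[/eqP->|xT] /orP[/eqP->|yT] // xy.
- by case: (pT y).
- by case: (pT x).
- exact: indT.
Qed.

Lemma independent0 (U : choiceType) : independent (fset0 : {fset element U}).
Proof. by apply/independentP => p q; rewrite inE. Qed.

Lemma weight_sub (R : realType) (U : choiceType) (nu : U -> R)
    (X Y : {fset U}) :
  (forall u, 0 <= nu u) -> {subset X <= Y} -> weight nu X <= weight nu Y.
Proof.
move=> nu0 XY; rewrite /weight (big_fsetID _ (mem X) Y) /=.
have -> : [fset x in Y | x \in X] = X.
  by apply/fsetP => x; rewrite !inE andb_idl //; apply: XY.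
by rewrite lerDl sumr_ge0.
Qed.

Lemma weightU1 (R : realType) (U : choiceType) (nu : U -> R) (X : {fset U}) u :
  u \notin X -> weight nu (u |` X) = nu u + weight nu X.
Proof. exact: big_fsetU1. Qed.

Lemma weight0 (R : realType) (U : choiceType) (nu : U -> R) :
  weight nu fset0 = 0.
Proof. exact: big_seq_fset0. Qed.

Lemma objective_le_weight (R : realType) (U : choiceType) (nu : U -> R)
    (S : {fset element U}) (F : {fset U}) :
  (forall u, 0 <= nu u) -> (forall p, p \in S -> p.1 \in F) ->
  objective nu S <= weight nu F.
Proof.
by move=> nu0 SF; apply: weight_sub => // u /imfsetP[p /= /SF ? ->].
Qed.

Lemma objectiveU1 (R : realType) (U : choiceType) (nu : U -> R)
    (T : {fset element U}) p :
  (forall q, q \in T -> q.1 <> p.1) ->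
  objective nu (p |` T) = nu p.1 + objective nu T.
Proof.
move=> pT; rewrite /objective imfsetU1 weightU1 //.
by apply/imfsetP => -[q /= qT] /esym; apply: pT.
Qed.

Lemma objective0 (R : realType) (U : choiceType) (nu : U -> R) :
  objective nu fset0 = 0.
Proof. by rewrite /objective imfset0 weight0. Qed.

(** The competitive ratio only speaks of a given optimum, so one is needed to apply it; it is a
    maximum over the finite powerset of [s]. *)
Lemma exists_OPT (R : realType) (U : choiceType) (nu : U -> R)
    (s : seq (element U)) :
  exists O, is_OPT nu s O.
Proof.
pose P := fpowerset [fset x in s].
have P0 : fset0 \in P by rewrite fpowersetE fsub0set.
pose i0 : P := [` P0].
have ind0 : `[< independent (val i0) >] by apply/asboolP/independent0.
case: (@Order.TotalTheory.arg_maxP _ _ _ i0 (fun X : P => `[< independent (val X) >])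
  (fun X : P => objective nu (val X)) ind0) => X /asboolP indX maxX.
exists (val X); split=> // [x xX|T sT indT].
  have := valP X; rewrite fpowersetE => /fsubsetP/(_ x xX).
  by rewrite !inE.
have TP : T \in P.
  by rewrite fpowersetE; apply/fsubsetP => x /sT xs; rewrite !inE.
by apply: (maxX [` TP]); apply/asboolP.
Qed.

(** * Runs of the algorithm on growing sequences *)

Lemma subfam_cat (U : choiceType) (s t : seq (element U)) n (X : {set 'I_n}) :
  (n <= size s)%N -> subfam (s ++ t) X = subfam s X.
Proof.
move=> ns; apply/fsetP => x; rewrite !inE /= mem_cat.
have [xs|xs] /= := boolP (x \in s).
  by apply: eq_existsb => i; rewrite index_cat xs.
apply/negbTE; rewrite negb_and; apply/orP; right.
apply/existsP => -[i /andP[_ /eqP ix]].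
have := ltn_ord i; rewrite ix index_cat (negbTE xs) ltnNge => /negP; apply.
exact: leq_trans ns (leq_addr _ _).
Qed.

(** Decisions cannot depend on the future: the oracle tables after [n] arrivals only see positions
    below [n]. *)
Lemma solution_at_cat (R : realType) (A : algorithm R) (U : choiceType)
    (nu : U -> R) (s t : seq (element U)) n :
  (n <= size s)%N -> solution_at A nu (s ++ t) n = solution_at A nu s n.
Proof.
elim: n => //= n IHn ns; rewrite IHn 1?ltnW //.
congr (update _ (A _ _ _ _)); apply/ffunP => X; rewrite !ffunE.
  by rewrite subfam_cat.
by rewrite subfam_cat.
Qed.

Definition output (R : realType) (A : algorithm R) (U : choiceType)
    (nu : U -> R) (s : seq (element U)) : {fset element U} :=
  solution A nu s (size s).

Lemma output_mem (R : realType) (A : algorithm R) (U : choiceType)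
    (nu : U -> R) (s : seq (element U)) p :
  p \in output A nu s -> p \in s.
Proof. by rewrite !inE => /andP[]. Qed.

Lemma output_nil (R : realType) (A : algorithm R) (U : choiceType)
    (nu : U -> R) : output A nu [::] = fset0.
Proof.
by apply/fsetP => p; rewrite [RHS]inE; apply/negP => /output_mem.
Qed.

(** Nothing discarded comes back. Together with independence and the ratio, this is all that the
    adversary uses about the algorithm. *)
Lemma output_rcons (R : realType) (A : algorithm R) (U : choiceType)
    (nu : U -> R) (s : seq (element U)) x p :
  p \in output A nu (rcons s x) -> p = x \/ p \in output A nu s.
Proof.
rewrite /output size_rcons /solution /= !inE /= => /andP[px /existsP[i]].
case/andP=> + /eqP ip.
rewrite -{1}cats1 solution_at_cat // inE => /orP[/imsetP[j]|].
  rewrite inE => /andP[_ jS] ij; right.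
  have ps : p \in s.
    apply: contraT => ps; have := ltn_ord j.
    have -> : nat_of_ord j = index p (rcons s x) by rewrite -ip ij.
    by rewrite -cats1 index_cat (negbTE ps) ltnNge leq_addr.
  rewrite ps; apply/existsP; exists j; rewrite jS /=.
  have -> : nat_of_ord j = index p (rcons s x) by rewrite -ip ij.
  by rewrite -cats1 index_cat ps.
case: ifP => _; rewrite inE // => /eqP iE; left.
move: px; rewrite mem_rcons inE => /orP[/eqP //|ps].
move: ip; rewrite iE /= -cats1 index_cat ps => ip.
by move: ps; rewrite -index_mem -ip ltnn.
Qed.

Lemma output_independent (R : realType) (A : algorithm R) (U : choiceType)
    (nu : U -> R) (s : seq (element U)) :
  feasible A -> (forall u, 0 <= nu u) -> uniq s -> independent (output A nu s).
Proof. by move=> fA nu0 us; apply: fA. Qed.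

(* Copies of the items of F, sent in fresh parts, add nothing to the value of the
   algorithm, which is at most the weight of F, but OPT collects them all. *)
Lemma copies_bound (R : realType) (A : algorithm R) r (U : choiceType)
    (nu : U -> R) (s : seq (element U)) (T : {fset element U}) (F : {fset U}) :
  has_competitive_ratio A r -> 0 < r -> (forall u, 0 <= nu u) -> uniq s ->
  {subset T <= s} -> independent T ->
  (forall p, p \in output A nu s -> p.1 \in F) ->
  (forall p, p \in T -> p.1 \notin F) ->
  r * (objective nu T + weight nu F) <= weight nu F.
Proof.
move=> ratioA r0 nu0 us Ts indT outF TF.
(* Here [l] lists the items of [F] still to be copied. Each copy moves one item from the sum into
   [T], while the bound [weight nu F] on the algorithm stays fixed. *)
suff copy (l : seq U) : uniq l -> {subset l <= F} ->
    forall s (T : {fset element U}), uniq s -> {subset T <= s} ->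
    independent T -> (forall p, p \in output A nu s -> p.1 \in F) ->
    (forall p, p \in T -> p.1 \notin l) ->
    r * (objective nu T + \sum_(u <- l) nu u) <= weight nu F.
  by apply: (copy F (fset_uniq F) _ s T).
elim: l => [_ _|u l IHl /= /andP[ul unl] lF] {s T us Ts indT outF TF} s T us Ts
    indT outF Tl.
  rewrite big_nil addr0; apply: le_trans (objective_le_weight nu0 outF).
  have [O [sO indO maxO]] := exists_OPT nu s.
  apply: le_trans (ratioA _ _ _ _ nu0 us (And3 sO indO maxO)).
  by rewrite ler_pM2l //; apply: maxO.
have [i is_] := fresh_nat (map snd s).
have uis : (u, i) \notin s.
  by apply: contra is_ => uis; apply/mapP; exists (u, i).
rewrite big_cons addrCA addrA -(@objectiveU1 _ _ nu T (u, i)); last first.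
  by move=> q /Tl + qu; rewrite inE qu eqxx.
apply: (IHl unl _ (rcons s (u, i))).
- by move=> x xl; apply: lF; rewrite inE xl orbT.
- by rewrite rcons_uniq uis.
- move=> x; rewrite !inE mem_rcons inE => /orP[->//|/Ts ->].
  by rewrite orbT.
- apply: independentU1 => // q /Ts qs qi; case/negP: is_.
  by apply/mapP; exists q.
- move=> p /output_rcons[->|/outF //]; apply: lF; exact: mem_head.
- move=> p; rewrite !inE => /orP[/eqP->//|/Tl].
  by rewrite inE negb_or => /andP[].
Qed.

(** * Analysis of the recurrence *)

(* With t = y / w, a round replaces t by t - (alpha t^2 - beta t + 1)/(1 + alpha t)
   where beta = alpha^2 - alpha - 1; the quadratic has discriminant
   (alpha^2 - 3 alpha + 1)(alpha^2 + alpha + 1) < 0. *)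
Lemma ratio_decrease (R : realType) (alpha : R) :
  0 < alpha -> alpha ^+ 2 - 3 * alpha + 1 < 0 ->
  exists2 c : R, 0 < c & forall w y : R, 0 < y -> y <= w ->
    ((alpha - 1) * (w + alpha * y) - alpha * w) * w
      <= (y - c * w) * (w + alpha * y).
Proof.
move=> a0 disc; pose beta := alpha ^+ 2 - alpha - 1.
(* The minimum of [alpha t^2 - beta t + 1], reached at [t = beta / (2 alpha)]. *)
pose d := (4 * alpha - beta ^+ 2) / (4 * alpha).
have d0 : 0 < d.
  rewrite divr_gt0 ?mulr_gt0 //.
  have -> : 4 * alpha - beta ^+ 2 =
      - (alpha ^+ 2 - 3 * alpha + 1) * (alpha ^+ 2 + alpha + 1).
    by rewrite /beta; ring.
  by rewrite mulr_gt0 ?oppr_gt0 // !addr_gt0 // exprn_gt0.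
have a1 : 0 < 1 + alpha by rewrite addr_gt0.
(* Since [t <= 1], the denominator [1 + alpha t] is at most [1 + alpha]. *)
exists (d / (1 + alpha)); first by rewrite divr_gt0.
move=> w y y0 yw; have w0 := lt_le_trans y0 yw.
have sq : d * w ^+ 2 <= alpha * y ^+ 2 - beta * y * w + w ^+ 2.
  rewrite -subr_ge0.
  have -> : alpha * y ^+ 2 - beta * y * w + w ^+ 2 - d * w ^+ 2 =
      alpha * (y - beta * w / (2 * alpha)) ^+ 2.
    by rewrite /d; field; rewrite gt_eqF.
  by rewrite mulr_ge0 ?sqr_ge0 // ltW.
have cw : d / (1 + alpha) * w * (w + alpha * y) <= d * w ^+ 2.
  have -> : d * w ^+ 2 = d / (1 + alpha) * w * (w + alpha * w).
    by field; rewrite gt_eqF.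
  rewrite ler_pM2l; last by rewrite mulr_gt0 // divr_gt0.
  by rewrite lerD2l ler_pM2l.
rewrite -subr_ge0.
have -> : (y - d / (1 + alpha) * w) * (w + alpha * y) -
    ((alpha - 1) * (w + alpha * y) - alpha * w) * w =
    (alpha * y ^+ 2 - beta * y * w + w ^+ 2 - d * w ^+ 2) +
    (d * w ^+ 2 - d / (1 + alpha) * w * (w + alpha * y)).
  by rewrite /beta; ring.
by rewrite addr_ge0 // subr_ge0.
Qed.

(** * The adversary *)

(* Items carry their own weight, so that the adversary can create items of any
   weight on the fly; the second component makes room for distinct items. *)
Definition item (R : realType) : choiceType := (R * nat)%type.

Definition item_weight (R : realType) (u : item R) : R := `|u.1|.

Lemma item_weight_ge0 (R : realType) (u : item R) : 0 <= item_weight u.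
Proof. exact: normr_ge0. Qed.
#[local] Hint Resolve item_weight_ge0 : core.

Lemma fresh_item (R : realType) (s : seq (element (item R))) (v : R) :
  0 <= v -> exists u, item_weight u = v /\ u \notin map fst s.
Proof.
move=> v0; have [n ns] := fresh_nat (map (fun p => p.1.2) s).
exists (v, n); split; first exact: ger0_norm.
by apply: contra ns => /mapP[p ps pE]; apply/mapP; exists p; rewrite // -pE.
Qed.

(* The last hypothesis says that the algorithm cannot afford to reject both new
   items; c is the one that it keeps. *)
Lemma offer_pair (R : realType) (A : algorithm R) r
    (s : seq (element (item R))) (H : {fset element (item R)})
    (F : {fset item R}) (w : R) :
  feasible A -> has_competitive_ratio A r -> 0 < r -> 0 <= w -> uniq s ->
  {subset H <= s} -> independent H -> (forall p, p \in H -> p.2 <> 0%N) ->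
  (forall p, p \in H -> p.1 \notin F) ->
  (forall p, p \in output A (@item_weight R) s -> p.1 \in F) ->
  {subset F <= map fst s} ->
  weight (@item_weight R) F
    < r * (w + objective (@item_weight R) H + weight (@item_weight R) F) ->
  exists s' c d, [/\ [/\ item_weight c = w, item_weight d = w, d != c,
      c \notin map fst s & d \notin map fst s],
    uniq s', {subset s <= s'}, (c, 0%N) \in s' /\ (d, 0%N) \in s' &
    forall p, p \in output A (@item_weight R) s' ->
      p = (c, 0%N) \/ (p \in output A (@item_weight R) s /\ p.2 <> 0%N)].
Proof.
move=> fA ratioA r0 w0 us Hs indH H0 HF outF Fs.
rewrite ltNge => /negP big.
have [c [cw cs]] := fresh_item s w0.
have [d [dw]] := fresh_item (rcons s (c, 0%N)) w0.
rewrite map_rcons mem_rcons inE negb_or => /andP[/= dc ds].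
have notin (e : item R) t : e \notin map fst t -> (e, 0%N) \notin t.
  by apply: contra => et; apply/mapP; exists (e, 0%N).
pose s' := rcons (rcons s (c, 0%N)) (d, 0%N).
have us' : uniq s'.
  rewrite !rcons_uniq us mem_rcons inE !negb_or !notin // !andbT.
  by apply: contra dc => /eqP/= ->.
have ss' : {subset s <= s'} by move=> x xs; rewrite !(mem_rcons, inE) xs !orbT.
have cs' : (c, 0%N) \in s' by rewrite !(mem_rcons, inE) eqxx !orbT.
have ds' : (d, 0%N) \in s' by rewrite !(mem_rcons, inE) eqxx.
have := output_independent fA (@item_weight_ge0 R) us'; set out' := output _ _ _.
move=> /independentP ind'.
have out'P p : p \in out' ->
    [\/ p = (c, 0%N), p = (d, 0%N) | p \in output A (@item_weight R) s].
  move=> /output_rcons[->|/output_rcons[->|pS]].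
  - exact: Or32.
  - exact: Or31.
  - exact: Or33.
have zero p q : p \in out' -> q \in out' -> p.2 = 0%N -> q.2 = 0%N -> p = q.
  by move=> pS qS p0 q0; apply: ind'; rewrite ?p0.
have [cS|cS] := boolP ((c, 0%N) \in out').
  exists s', c, d; split=> // p pS.
  have [p0|/eqP p0] := eqVneq p.2 0%N; first by left; apply: zero.
  by case: (out'P p pS) => [?|pE|?]; [left| by rewrite pE in p0|right].
have [dS|dS] := boolP ((d, 0%N) \in out').
  exists s', d, c; split=> //; first by rewrite eq_sym.
  move=> p pS.
  have [p0|/eqP p0] := eqVneq p.2 0%N; first by left; apply: zero.
  by case: (out'P p pS) => [pE|?|?]; [by rewrite pE in p0|left|right].
(* Both items are rejected: OPT takes [c] in part 0 next to [H], and closing copies of [F]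
   contradict [big]. *)
case: big.
have cH p : p \in H -> p.1 <> c.
  by move=> /Hs ps pc; case/negP: cs; rewrite -pc map_f.
rewrite -cw -(@objectiveU1 _ _ _ H (c, 0%N)) //.
apply: (copies_bound ratioA r0 (@item_weight_ge0 R) us').
- by move=> x; rewrite !inE => /orP[/eqP->|/Hs/ss'].
- by apply: independentU1 => // q /H0.
- move=> p pS; case: (out'P p pS) => [pE|pE|/outF //].
    by rewrite pE (negbTE cS) in pS.
  by rewrite pE (negbTE dS) in pS.
- move=> p; rewrite !inE => /orP[/eqP->|/HF //].
  by apply: contra cs => /Fs.
Qed.

(* E contains what the algorithm may hold outside part 0, and H is the part of
   OPT outside part 0. The equation in y says that an algorithm that gives up the
   distractor for the copy of a has exactly 1 / alpha times the value of OPT. *)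
Lemma rounds (R : realType) (A : algorithm R) (r alpha c : R) (n : nat) :
  feasible A -> has_competitive_ratio A r -> 0 < r -> 0 < alpha ->
  1 < r * alpha ->
  (forall w y : R, 0 < y -> y <= w ->
    ((alpha - 1) * (w + alpha * y) - alpha * w) * w
      <= (y - c * w) * (w + alpha * y)) ->
  0 < c ->
  forall (s : seq (element (item R))) (E : {fset item R})
    (H : {fset element (item R)}) (a b : item R) (y : R),
  uniq s -> {subset a |` E <= map fst s} -> a \notin E -> b \notin a |` E ->
  (b, 0%N) \in s -> {subset H <= s} -> independent H ->
  (forall p, p \in H -> p.2 <> 0%N) ->
  (forall p, p \in H -> p.1 \notin a |` E) ->
  (forall p, p \in H -> p.1 <> b) ->
  (forall p, p \in output A (@item_weight R) s -> p.1 \in E \/ p = (a, 0%N)) ->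
  item_weight b = item_weight a -> 0 < item_weight a ->
  objective (@item_weight R) H + weight (@item_weight R) E
    + 2 * item_weight a + y
    = alpha * (weight (@item_weight R) E + item_weight a) ->
  y <= item_weight a -> y <= n%:R * c * item_weight a -> False.
Proof.
move=> fA ratioA r0 al0 ral decr c0.
(* [X] is a value reached by OPT and [D] bounds the value of the algorithm. *)
have win (X D : R) : r * X <= D -> 0 < D -> alpha * D <= X -> False.
  move=> XD D0 DX; suff: D < r * X by rewrite ltNge XD.
  rewrite (lt_le_trans _ (_ : r * (alpha * D) <= _)) ?ler_pM2l //.
  by rewrite mulrA -[ltLHS]mul1r ltr_pM2r.
(* [n] bounds the number of rounds left: [y / item_weight a] is at most [n * c] and drops by at
   least [c] per round. *)
elim/ltn_ind: n => n IHn s E H a b y us Fs aE baE bs Hs indH H0 HaE Hb outE ba a0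
  eqy ya yn.
set nu := @item_weight R in IHn outE ba a0 eqy ya yn *.
have nu0 : forall u, 0 <= nu u by exact: item_weight_ge0.
have E0 : 0 <= weight nu E by apply: sumr_ge0.
have outaE p : p \in output A nu s -> p.1 \in a |` E.
  by move=> /outE[pE|->]; rewrite !inE ?pE ?eqxx ?orbT.
have indbH : independent ((b, 0%N) |` H) by apply: independentU1 => // q /H0.
have objbH : objective nu ((b, 0%N) |` H) = nu a + objective nu H.
  by rewrite objectiveU1 //= -ba.
have bH : {subset (b, 0%N) |` H <= s}.
  by move=> x; rewrite !inE => /orP[/eqP->|/Hs].
have bHaE p : p \in (b, 0%N) |` H -> p.1 \notin a |` E.
  by rewrite in_fset1U => /orP[/eqP->|/HaE].
(* If [y <= 0], the adversary stops at once: OPT takes [b], [H] and fresh copies of [a] and [E],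
   which by [eqy] is at least [alpha] times what the algorithm may hold. *)
have y0 : 0 < y.
  rewrite ltNge; apply/negP => y_le0.
  have := copies_bound ratioA r0 nu0 us bH indbH outaE bHaE.
  rewrite objbH weightU1 // => /win; apply; rewrite -/nu; lra.
case: n IHn yn => [|n] IHn yn; first by move: yn; rewrite mul0r mul0r leNgt y0.
have [e [ey es]] := fresh_item s (ltW y0).
have eaE : e \notin a |` E by apply: contra es => /Fs.
have [q] := fresh_nat (0%N :: map snd s).
rewrite inE negb_or => /andP[/eqP q0 qs].
have qsP p : p \in s -> p.2 <> q.
  by move=> ps pq; case/negP: qs; rewrite -pq map_f.
have esP p : p \in s -> p.1 <> e.
  by move=> ps pe; case/negP: es; rewrite -pe map_f.
have ae : a <> e by move=> ae; case/negP: eaE; rewrite -ae fset1U1.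
pose s2 := rcons (rcons s (e, q)) (a, q).
have us2 : uniq s2.
  rewrite !rcons_uniq us mem_rcons in_cons negb_or -!andbA andbT.
  apply/and3P; split.
  - by apply/eqP => -[].
  - by apply/negP => /qsP.
  - by apply/negP => /qsP.
have ss2 : {subset s <= s2}.
  by move=> x xs; rewrite !(mem_rcons, in_cons) xs !orbT.
have es2 : (e, q) \in s2 by rewrite !(mem_rcons, in_cons) eqxx !orbT.
have as2 : (a, q) \in s2 by rewrite !(mem_rcons, in_cons) eqxx.
have out2P p : p \in output A nu s2 ->
    [\/ p = (a, q), p = (e, q) | p \in output A nu s].
  move=> /output_rcons[->|/output_rcons[->|pS]].
  - exact: Or31.
  - exact: Or32.
  - exact: Or33.
have /independentP ind2 := output_independent fA nu0 us2.
(* Holding [(a, q)] excludes [(e, q)]. OPT then has [e], [b], [H] and fresh copies of [a] and [E]: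
   by [eqy], exactly [alpha] times the weight of [a] and [E]. *)
have [aS|aS] := boolP ((a, q) \in output A nu s2).
  have ebs p : p \in (b, 0%N) |` H -> p.1 <> e /\ p.2 <> q.
    by move=> /bH ps; split; [apply: esP|apply: qsP].
  have := @copies_bound _ _ _ _ _ _ ((e, q) |` ((b, 0%N) |` H)) (a |` E)
    ratioA r0 nu0 us2.
  rewrite objectiveU1 => [|p /ebs[] //].
  rewrite objbH weightU1 // /= [nu e]ey => bound.
  apply: (win (y + (nu a + objective nu H) + (nu a + weight nu E))
    (nu a + weight nu E)); rewrite -/nu; [|lra|lra].
  apply: bound.
  - by move=> x; rewrite in_fset1U => /orP[/eqP->//|/bH/ss2].
  - by apply: independentU1 => // p /ebs[].
  - move=> p pS; case: (out2P p pS) => [->|pE|/outaE //]; first exact: fset1U1.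
    by case: ae; have := ind2 _ _ aS pS; rewrite pE => /(_ erefl)[].
  - by move=> p; rewrite in_fset1U => /orP[/eqP->|/bHaE].
(* By [eqy], this [w] together with the weights of [H], [e], [a] and [E] is exactly [alpha] times
   the weight of [e], [a] and [E], so rejecting both new items violates the ratio. *)
pose w := nu a + alpha * y.
have aew : weight nu (e |` (a |` E)) = y + (nu a + weight nu E).
  by rewrite !weightU1 // [nu e]ey.
have w0 : 0 < w by rewrite addr_gt0 // mulr_gt0.
have [|||||||s3 [c' [d' [[c'w d'w dc cs ds] us3 ss3 [cs3 ds3] out3]]]] :=
  @offer_pair _ A r s2 H (e |` (a |` E)) w fA ratioA r0 (ltW w0) us2.
- by move=> x /Hs/ss2.
- by [].
- by [].
- move=> p pH; rewrite in_fset1U negb_or HaE // andbT.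
  by apply/eqP/esP/Hs.
- move=> p /out2P[pE|->|/outaE pS]; last by rewrite in_fset1U pS orbT.
    by rewrite pE in_fset1U fset1U1 orbT.
  exact: fset1U1.
- move=> u; rewrite in_fset1U => /orP[/eqP->|/Fs].
    by apply/mapP; exists (e, q).
  by case/mapP => p ps ->; apply/mapP; exists p => //; apply: ss2.
- rewrite aew ltNge; apply/negP => /win; apply; rewrite /w -/nu; lra.
have {}c'w : nu c' = w by [].
have {}d'w : nu d' = w by [].
have c0P p : p \in s2 -> p.1 <> c'.
  by move=> ps pc; case/negP: cs; rewrite -pc map_f.
have d0P p : p \in s2 -> p.1 <> d'.
  by move=> ps pd; case/negP: ds; rewrite -pd map_f.
have eE u : u \in e |` E -> exists2 p, p \in s2 & p.1 = u.
  rewrite in_fset1U => /orP[/eqP->|uE]; first by exists (e, q).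
  have /Fs/mapP[p ps ->] : u \in a |` E by rewrite in_fset1U uE orbT.
  by exists p => //; apply: ss2.
have eNE : e \notin E.
  by apply: contra eaE => ?; apply/fset1UP; right.
have aH p : p \in H -> p.1 <> a.
  by move=> /HaE/negP pa pE; case: pa; rewrite pE fset1U1.
have := decr _ _ y0 ya; rewrite -/w => decrw.
(* The solution of [eqy] for the next state: [(a, q)] joins [H], as [a] is lost to the algorithm,
   and [e] joins [E]. *)
pose y' := (alpha - 1) * w - alpha * nu a.
apply: (IHn n (ltnSn n) s3 (e |` E) ((a, q) |` H) c' d' y') => //.
- move=> u; rewrite in_fset1U => /orP[/eqP->|/eE[p ps <-]].
    by apply/mapP; exists (c', 0%N).
  by apply/mapP; exists p => //; apply: ss3.
- by apply/negP => /eE[p /c0P].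
- rewrite in_fset1U negb_or dc /=; by apply/negP => /eE[p /d0P].
- by move=> x; rewrite in_fset1U => /orP[/eqP->|/Hs/ss2/ss3 //]; apply: ss3.
- by apply: independentU1 => // p /Hs/qsP.
- by move=> p; rewrite in_fset1U => /orP[/eqP->|/H0].
- move=> p; rewrite !in_fset1U !negb_or => /orP[/eqP->|pH] /=.
    by rewrite aE andbT; apply/andP; split; apply/eqP => //; apply: (c0P _ as2).
  have := HaE p pH; rewrite in_fset1U negb_or => /andP[_ ->]; rewrite andbT.
  apply/andP; split; apply/eqP; first by apply/c0P/ss2/Hs.
  exact/esP/Hs.
- move=> p; rewrite in_fset1U => /orP[/eqP->|/Hs/ss2/d0P //].
  exact: (d0P _ as2).
- move=> p /out3[->|[pS p0]]; [by right|left].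
  rewrite in_fset1U; case: (out2P p pS) => [pE|->|/outE[->|pE]].
  + by rewrite pE (negbTE aS) in pS.
  + by rewrite eqxx.
  + by rewrite orbT.
  + by rewrite pE in p0.
- by rewrite d'w c'w.
- by rewrite c'w.
- rewrite objectiveU1 // weightU1 // [nu e]ey -/nu c'w /y' /w /=; lra.
- rewrite c'w -(ler_pM2r a0); apply: le_trans decrw _.
  rewrite [leRHS]mulrC ler_pM2r //; apply: le_trans ya.
  by rewrite gerBl mulr_ge0 // ltW.
- rewrite c'w -(ler_pM2r a0); apply: le_trans decrw _.
  rewrite [leRHS]mulrAC ler_pM2r // lerBlDr.
  by apply: le_trans yn _; rewrite -natr1 !mulrDl mul1r.
Qed.

Theorem theorem6p2 (R : realType) (alpha : R)
    (alpha_gt0 : 0 < alpha) (alpha_lt : alpha < (3 + Num.sqrt 5) / 2) :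
  ~ exists (A : algorithm R) (r : R),
      [/\ feasible A, 1 / alpha < r & has_competitive_ratio A r].
Proof.
move=> [A [r [fA rgt ratioA]]].
have r0 : 0 < r by apply: lt_trans rgt; rewrite divr_gt0.
(* Raising [alpha] keeps [r] above its inverse; 3/2 is the midpoint of the roots of [X^2 - 3 X + 1],
   so [al] lies strictly between them. *)
pose al := Num.max alpha (3 / 2).
have al_ge : 3 / 2 <= al by rewrite le_max lexx orbT.
have al0 : 0 < al by apply: lt_le_trans al_ge; rewrite divr_gt0.
have ral : 1 < r * al.
  apply: (@lt_le_trans _ _ (r * alpha)); first by rewrite -ltr_pdivrMr.
  by rewrite ler_pM2l // le_max lexx.
have sqrt5 : Num.sqrt 5 ^+ 2 = 5 :> R by rewrite sqr_sqrtr.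
have sqrt5_ge0 : 0 <= Num.sqrt 5 :> R := sqrtr_ge0 _.
have sqrt5_gt0 : 0 < Num.sqrt 5 :> R by rewrite sqrtr_gt0.
have al_lt : al < (3 + Num.sqrt 5) / 2 by rewrite gt_max alpha_lt /=; lra.
have disc : al ^+ 2 - 3 * al + 1 < 0.
  have : (2 * al - 3) ^+ 2 < 5 by rewrite -sqrt5 ltr_pXn2r ?nnegrE //; lra.
  by rewrite !expr2; lra.
have al_lt3 : al - 2 <= 1.
  by rewrite leNgt; apply/negP => al3; move: disc; rewrite expr2; nra.
have [c c0 decr] := ratio_decrease al0 disc.
have sub0 (T : choiceType) (l : seq T) : {subset (fset0 : {fset T}) <= l}.
  by move=> x; rewrite inE.
(* The opening: an algorithm that rejects both items of weight 1 has value 0 against a positive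
   optimum. *)
have [|||||||s [a [b [[aw bw ba _ _] us _ [sa sb] outs]]]] :=
  @offer_pair _ A r [::] fset0 fset0 1 fA ratioA r0 ler01 isT.
- exact: sub0.
- exact: independent0.
- by move=> p; rewrite inE.
- by move=> p; rewrite inE.
- by move=> p; rewrite output_nil inE.
- exact: sub0.
- by rewrite weight0 objective0 !addr0 mulr1.
(* With [E] and [H] empty and weight 1, [eqy] reads [2 + y = al]; the choice of [n] gives
   [y <= 1 <= n * c]. *)
apply: (rounds fA ratioA r0 al0 ral decr c0 (n := Num.bound c^-1) (s := s)
  (E := fset0) (H := fset0) (a := a) (b := b) (y := al - 2)) => //.
- move=> u; rewrite !inE orbF => /eqP->.
  by apply/mapP; exists (a, 0%N).
- by rewrite !inE orbF.
- exact: independent0.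
- by move=> p /outs[->|[]]; [right|rewrite output_nil inE].
- by rewrite aw bw.
- by rewrite aw.
- by rewrite objective0 weight0 aw; lra.
- by rewrite aw.
- rewrite aw mulr1; apply: le_trans al_lt3 _.
  by rewrite -ler_pdivrMr // mul1r ltW // archi_boundP // invr_ge0 ltW.
Qed.
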